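(* For any non-decreasing boolean function $f:\{0,1\}^n\to\{0,1\}$, we have $$E\big(S_n\,\big|\,f=1\big)\,=\,\frac1p\,E\big(|\mathcal P(f)|\,\big|\,f=1\big)\,.$$
   Context: Let $n\geq 1$, let $p$ be a fixed parameter in $[0,1]$, and let $\Omega=\{0,1\}^n$, with elements $\omega=(\omega(1),\dots,\omega(n))$. The probability $P$ on $\Omega$ is the Bernoulli product measure of parameter $p$: $P(\omega)=\prod_{1\leq i\leq n}p^{\omega(i)}(1-p)^{1-\omega(i)}$, and $E$ is the expectation with respect to $P$. For $\omega\in\Omega$ and $i\in\{1,\dots,n\}$, $\omega^i$ (respectively $\omega_i$) denotes the configuration equal to $\omega$ except that its $i$-th component is set to $1$ (respectively to $0$). A boolean function is a function $f:\Omega\to\{0,1\}$; it is non-decreasing if $f(\omega_i)\leq f(\omega^i)$ for all $\omega\in\Omega$ and all $i\in\{1,\dots,n\}$. The coordinate $i$ is pivotal for $f$ in $\omega$ if $f(\omega^i)\neq f(\omega_i)$. The pivotal set $\mathcal P(f,\omega)\subset\{1,\dots,n\}$ is the set of the coordinates that are pivotal for $f$ in $\omega$; $\mathcal P(f)$ denotes the random set $\omega\mapsto\mathcal P(f,\omega)$, and $|\cdot|$ denotes cardinality. For $i\in\{1,\dots,n\}$, $X_i(\omega)=\dfrac{\omega(i)}{p}-\dfrac{1-\omega(i)}{1-p}$, and $S_n=X_1+\cdots+X_n$. For a random variable $Y$ on $\Omega$, $E(Y\,|\,f=1)$ denotes the elementary conditional expectation $\frac{1}{P(f=1)}\sum_{\omega:\,f(\omega)=1}Y(\omega)P(\omega)$.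 *)

(* Defs.v *)
From mathcomp Require Import all_boot all_order all_algebra.
From mathcomp Require Import reals.
Set Implicit Arguments.
Unset Strict Implicit.
Unset Printing Implicit Defensive.
Import Order.TTheory GRing.Theory Num.Theory.
Local Open Scope ring_scope.

(* The values 0 and 1 are the booleans; coordinates 1..n are numbered 0..n-1. *)
Definition config (n : nat) := {ffun 'I_n -> bool}.

Definition set_coord n (w : config n) (i : 'I_n) (b : bool) : config n :=
  [ffun j => if j == i then b else w j].

Definition bernoulli_mass (R : realType) n (p : R) (w : config n) : R :=
  \prod_(i < n) (p ^+ w i * (1 - p) ^+ (1 - w i)%N).

Definition prob (R : realType) n (p : R) (A : {set config n}) : R :=
  \sum_(w in A) bernoulli_mass p w.

(* When [prob p A = 0], division by zero in MathComp makes this 0. *)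
Definition cond_expectation (R : realType) n (p : R) (Y : config n -> R)
    (A : {set config n}) : R :=
  (prob p A)^-1 * \sum_(w in A) Y w * bernoulli_mass p w.

Definition nondecreasing_bool n (f : config n -> bool) : Prop :=
  forall (w : config n) (i : 'I_n),
    (f (set_coord w i false) <= f (set_coord w i true))%N.

Definition pivotal_set n (f : config n -> bool) (w : config n) : {set 'I_n} :=
  [set i | f (set_coord w i true) != f (set_coord w i false)].

(* Meaningful only for [0 < p < 1]; totalized division is arbitrary at 0 and 1. *)
Definition score (R : realType) n (p : R) (i : 'I_n) (w : config n) : R :=
  (w i)%:R / p - (1 - (w i)%:R) / (1 - p).

Definition score_sum (R : realType) n (p : R) (w : config n) : R :=
  \sum_(i < n) score p i w.

(* Main.v *)
(* Pair each configuration with the one obtained by flipping coordinate [i].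
   On a pair with common weight [q] off [i], the score times the mass is [q]
   at the upper configuration and [- q] at the lower one, so the pair
   contributes [(f(w^i) - f(w_i)) q].  By monotonicity this is [q] if [i] is
   pivotal and [0] otherwise; when [i] is pivotal only the upper configuration,
   of mass [p q], lies in the event [f = 1]. *)
Require Import Defs.
From mathcomp Require Import all_boot all_order all_algebra.
From mathcomp Require Import reals.
From mathcomp Require Import ring.
Import Order.TTheory GRing.Theory Num.Theory.
Local Open Scope ring_scope.

Lemma set_coord_id n (w : config n) (i : 'I_n) : set_coord w i (w i) = w.
Proof. by apply/ffunP => j; rewrite ffunE; case: eqP => [->|]. Qed.

Lemma set_coord_eq n (w : config n) (i : 'I_n) b : set_coord w i b i = b.
Proof. by rewrite ffunE eqxx. Qed.

Lemma set_coord_set n (w : config n) (i : 'I_n) b c :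
  set_coord (set_coord w i b) i c = set_coord w i c.
Proof. by apply/ffunP => j; rewrite !ffunE; case: eqP. Qed.

(** Each pair is indexed by its upper member, the one with [w i] true. *)
Lemma sum_config_pair (V : nmodType) n (i : 'I_n) (F : config n -> V) :
  \sum_w F w =
  \sum_(w : config n | w i)
    (F (set_coord w i true) + F (set_coord w i false)).
Proof.
rewrite (bigID (fun w : config n => w i)) /= big_split /=; congr (_ + _).
  by apply: eq_bigr => w wi; rewrite -[in LHS](set_coord_id _ w i) wi.
rewrite (reindex_onto (fun w => set_coord w i false)
                      (fun w => set_coord w i true)) /=; last first.
  by move=> w /negbTE wi; rewrite set_coord_set -wi set_coord_id.
apply: eq_bigl => w; rewrite set_coord_set set_coord_eq /=.
apply/eqP/idP => [<-|wi]; first by rewrite set_coord_eq.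
by rewrite -wi set_coord_id.
Qed.

Lemma bernoulli_mass_set_coord (R : realType) n (p : R) (w : config n) i b :
  bernoulli_mass p (set_coord w i b) =
  p ^+ b * (1 - p) ^+ (1 - b)%N *
  \prod_(j < n | j != i) (p ^+ w j * (1 - p) ^+ (1 - w j)%N).
Proof.
rewrite /bernoulli_mass (bigD1 i) //= set_coord_eq; congr (_ * _).
by apply: eq_bigr => j /negbTE ji; rewrite ffunE ji.
Qed.

Lemma pivotal_set_coord n (f : config n -> bool) (w : config n) i b :
  (i \in pivotal_set f (set_coord w i b)) = (i \in pivotal_set f w).
Proof. by rewrite !inE !set_coord_set. Qed.

Lemma sum_score_pivotal (R : realType) n (p : R) (f : config n -> bool) i :
  0 < p -> p < 1 -> nondecreasing_bool f ->
  \sum_(w | f w) score p i w * bernoulli_mass p w =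
  p^-1 * \sum_(w | f w) (i \in pivotal_set f w)%:R * bernoulli_mass p w.
Proof.
move=> p_gt0 p_lt1 f_mono.
have p_neq0 : p != 0 by rewrite gt_eqF.
have q_neq0 : 1 - p != 0 by rewrite subr_eq0 gt_eqF.
(* The event becomes an [if] in the summand, since pairing needs a sum over all configurations. *)
rewrite big_mkcond [in RHS]big_mkcond /= !(sum_config_pair _ _ i) mulr_sumr.
apply: eq_bigr => w _; rewrite !pivotal_set_coord inE.
rewrite /score !bernoulli_mass_set_coord !set_coord_eq.
move: (f_mono w i).
(* Monotonicity excludes one of the four value pairs; when both values are 1, the two score terms
   cancel. *)
case: (f _); case: (f _) => //= _; rewrite ?subn0 ?subnn ?expr0 ?expr1.
all: by field; rewrite ?p_neq0 ?q_neq0.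
Qed.

Theorem lemma7p1 (R : realType) (n : nat) (hn : (1 <= n)%N)
    (p : R) (hp0 : 0 < p) (hp1 : p < 1)
    (f : config n -> bool) (hf : nondecreasing_bool f) :
  cond_expectation p (score_sum p) [set w | f w] =
  p^-1 * cond_expectation p (fun w => #|pivotal_set f w|%:R) [set w | f w].
Proof.
(* The normalizing factor is common to both sides, so [prob p A = 0] needs no separate case. *)
rewrite /cond_expectation mulrCA; congr (_ * _).
under eq_bigl do rewrite inE.
under [in RHS]eq_bigl do rewrite inE.
under eq_bigr do rewrite /score_sum mulr_suml.
(* The cardinality is a sum of indicators over [i], which reduces the claim to one coordinate at a
   time. *)
under [in RHS]eq_bigr do
  rewrite -sum1_card natr_sum big_mkcond mulr_suml.
rewrite exchange_big [in RHS]exchange_big mulr_sumr /=.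
apply: eq_bigr => i _; rewrite sum_score_pivotal //; congr (_ * _).
by apply: eq_bigr => w _; case: (i \in _).
Qed.
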